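(* Let $d\ge 2$ be an integer, $p=d-1$, $\lambda>0$ and $u>0$, and let $\mathbf N\sim\mathrm{NDFHL}^{(d)}(\lambda,u)$. For $P>0$ define the capacity $$C(P)=\sup_{P_{\mathbf X}:\ \mathbb E\|\mathbf X\|^2\le P} I(\mathbf X;\mathbf X+\mathbf N),$$ where the supremum is over distributions of $\mathbf X\in\mathbb R^p$ independent of $\mathbf N$. Then $$C(P)=\frac{p}{2}\log P+O(1),\qquad P\to\infty.$$
   Context: For an integer $d\ge2$, $p=d-1$, $\lambda>0$, $u>0$, the distribution $\mathrm{NDFHL}^{(d)}(\lambda,u)$ is the probability law on $\mathbb R^{p}$ with density $$f_{\mathbf N}(\mathbf n)=\frac{\lambda}{2^{\frac d2-1}\pi^{\frac d2}}\left(\frac{u}{\rho(\mathbf n)}\right)^{\frac d2}e^{\lambda u}K_{\frac d2}\bigl(u\rho(\mathbf n)\bigr),\qquad \rho(\mathbf n)=\sqrt{\|\mathbf n\|^2+\lambda^2},$$ where $K_\nu$ is the modified Bessel function of the second kind. Equivalently, it is the law of $\sigma\sqrt{T}\,\mathbf Z$ where $\sigma>0$, $\mathbf Z\sim\mathcal N(\mathbf 0,\mathbf I_p)$ is independent of $T$, and $T$ is inverse Gaussian with mean $\lambda/(u\sigma^2)$ and shape parameter $\lambda^2/\sigma^2$. All logarithms are natural; $I(\cdot;\cdot)$ denotes mutual information. *)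

(* Defs.v *)
From HB Require Import structures.
From mathcomp Require Import all_boot all_order all_algebra.
From mathcomp Require Import all_classical all_reals all_analysis.



Unset Printing Implicit Defensive.

Import Order.TTheory GRing.Theory Num.Theory.
Import numFieldNormedType.Exports.

Local Open Scope classical_set_scope.
Local Open Scope ring_scope.

(* R^n is represented by n.-tuple R, with the product (Borel) sigma-algebra
   provided by MathComp-Analysis for tuples. *)

Section Defs.
Context {R : realType}.

Definition sqnorm {n : nat} (x : n.-tuple R) : R :=
  \sum_(i < n) (tnth x i) ^+ 2.

Definition vadd {n : nat} (x y : n.-tuple R) : n.-tuple R :=
  [tuple tnth x i + tnth y i | i < n].

(* Lebesgue integral of a nonnegative function on R^n, computed as the
   iterated one-dimensional Lebesgue integral (Tonelli). *)
Fixpoint leb_int (n : nat) : (n.-tuple R -> \bar R) -> \bar R :=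
  match n with
  | 0 => fun f => f [tuple]
  | n'.+1 => fun f =>
      (\int[@lebesgue_measure R]_x leb_int n' (fun t : n'.-tuple R => f (cons_tuple x t)))%E
  end.

Definition cosh (t : R) : R := (expR t + expR (- t)) / 2.

(* Modified Bessel function of the second kind, via its integral
   representation K_nu(z) = int_0^oo exp(-z cosh t) cosh(nu t) dt  (z > 0). *)
Definition BesselK (nu z : R) : R :=
  fine (\int[@lebesgue_measure R]_(t in `[0%R, +oo[)
          (expR (- z * cosh t) * cosh (nu * t))%:E)%E.

Definition ndfhl_density (d : nat) (lam u : R) (x : d.-1.-tuple R) : R :=
  let rho := Num.sqrt (sqnorm x + lam ^+ 2) in
  let h := d%:R / 2 in
  lam / (powR 2 (h - 1) * powR pi h) * powR (u / rho) h * expR (lam * u)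
  * BesselK h (u * rho).

Definition is_NDFHL (d : nat) (lam u : R)
    (mu : probability (d.-1.-tuple R) R) : Prop :=
  forall A : set (d.-1.-tuple R), measurable A ->
    mu A = leb_int d.-1 (fun x => (\1_A x * ndfhl_density d lam u x)%:E).

Definition is_density {dT} {T : measurableType dT}
    (Q P : set T -> \bar R) (g : T -> R) : Prop :=
  [/\ measurable_fun setT g, (forall x, 0 <= g x) &
      forall A, measurable A -> P A = (\int[Q]_(x in A) (g x)%:E)%E].

(* Kullback-Leibler divergence D(P || Q) (natural log):
   int g ln g dQ where g = dP/dQ if P << Q, and +oo otherwise.
   (All densities agree Q-a.e., so the infimum is just that common value.) *)
Definition KL {dT} {T : measurableType dT} (P Q : set T -> \bar R) : \bar R :=
  ereal_inf ([set +oo%E] `|`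
    [set (\int[Q]_x (g x * ln (g x))%:E)%E | g in is_density Q P]).

Definition MI_additive {n : nat} (PX PN : set (n.-tuple R) -> \bar R) : \bar R :=
  let PXN := (PX \x PN)%E in
  let PXY := pushforward PXN (fun xn => (xn.1, vadd xn.1 xn.2)) in
  let PY := pushforward PXN (fun xn => vadd xn.1 xn.2) in
  KL PXY (PX \x PY)%E.

Definition capacity {n : nat} (PN : set (n.-tuple R) -> \bar R) (P : R) : \bar R :=
  ereal_sup [set MI_additive PX PN | PX in
    [set PX : probability (n.-tuple R) R |
       (\int[PX]_x (sqnorm x)%:E <= P%:E)%E]].

End Defs.

(* Main.v *)
(* The density f of the noise is bounded and has exponential tails, because
   exp(-z cosh t) <= exp(-z/2) exp(-(z/2) cosh t) gives K_nu(z) = O(exp(-z/2))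
   away from z = 0.  Only two consequences matter: f <= C and m := E|N|_1 < oo.
   Both bounds compare with the Laplace density
   q_s(x) = (2s)^-n exp(-|x|_1/s), n = d - 1.

   Upper bound: with b the density of Y = X + N, the density of P_XY with respect
   to P_X x P_Y is f(y-x)/b(y), and
     ln (f(y-x)/b(y)) <= ln (C/q_s(y)) + q_s(y)/b(y).
   The last term integrates to int q_s = 1; with s = sqrt P the other one
   contributes n ln(2s) + ln C + E|Y|_1/s = (n/2) ln P + O(1).  All terms are
   nonnegative, so no integrability question arises.

   Lower bound: X has density q_s with s of order sqrt P, and the variational
   bound for the divergence is tested on s^n exp(-|y-x|_1), whose mean under
   P_X x P_Y is at most 1 since q_s <= (2s)^-n; this gives
   I(X;Y) >= n ln s - m. *)
Require Import Defs.
From HB Require Import structures.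
From mathcomp Require Import all_boot all_order all_algebra.
From mathcomp Require Import all_classical all_reals all_analysis.
From mathcomp Require Import measurable_realfun ring lra.
Import Order.TTheory GRing.Theory Num.Theory.
Import numFieldNormedType.Exports HBNNSimple.
Local Open Scope classical_set_scope.
Local Open Scope ring_scope.

Set Implicit Arguments.
Unset Strict Implicit.

(** * Integration *)

(* No integrability is required: oo - oo = -oo in \bar R. *)
Lemma le_integral_measurable d (T : measurableType d) (R : realType)
    (m : {measure set T -> \bar R}) (f g : T -> \bar R) :
  measurable_fun [set: T] f -> measurable_fun [set: T] g ->
  (forall x, (f x <= g x)%E) -> (\int[m]_x f x <= \int[m]_x g x)%E.
Proof.
move=> mf mg fg; rewrite (integralE m setT f) (integralE m setT g); apply: leeB.
  apply: ge0_le_integral => //.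
  - exact: measurable_funepos.
  - exact: measurable_funepos.
  - by move=> x _; apply: (@funepos_le _ _ setT f g); rewrite ?in_setT.
apply: ge0_le_integral => //.
- exact: measurable_funeneg.
- exact: measurable_funeneg.
- by move=> x _; apply: (@funeneg_le _ _ setT f g); rewrite ?in_setT.
Qed.

(** Built up from simple functions: [hf] treats one level set, [snn] sums the levels, and monotone
    convergence along [nnsfun_approx] reaches [f]. The link between [m] and [n] has the form of the
    last clause of [is_density], so densities from [KL] can be plugged in directly. *)
Lemma ge0_integral_density d (T : measurableType d) (R : realType)
    (m n : {measure set T -> \bar R}) (g : T -> R) (f : T -> \bar R) :
  measurable_fun [set: T] g -> (forall x, 0 <= g x) ->
  (forall A, measurable A -> m A = (\int[n]_(x in A) (g x)%:E)%E) ->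
  measurable_fun [set: T] f -> (forall x, (0 <= f x)%E) ->
  (\int[m]_x f x = \int[n]_x (f x * (g x)%:E))%E.
Proof.
move=> mg g0 mE mf f0.
pose f_ : {nnsfun T >-> R}^nat := nnsfun_approx measurableT mf.
have mEg : measurable_fun [set: T] (EFin \o g) by exact/measurable_EFinP.
have Hf x : (f_ n x)%:E @[n --> \oo] --> f x by exact: cvg_nnsfun_approx.
have hf k (h : {nnsfun T >-> R}) :
    (k%:E * m (h @^-1` [set k]) =
     \int[n]_x ((k * \1_(h @^-1` [set k]) x)%:E * (g x)%:E))%E.
  have [k0|k0] := leP 0 k; last first.
    rewrite preimage_nnfun0// measure0 mule0 integral0_eq// => x _.
    by rewrite indicE in_set0 mulr0 mul0e.
  rewrite mE// integral_mkcond epatch_indic -ge0_integralZl//.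
  - by apply: eq_integral => x _; rewrite EFinM -muleA [((g x)%:E * _)%E]muleC.
  - by apply: emeasurable_funM => //; exact/measurable_EFinP.
  - by move=> x _; rewrite mule_ge0 ?lee_fin.
have snn (h : {nnsfun T >-> R}) :
    (\int[m]_x (h x)%:E = \int[n]_x ((h x)%:E * (g x)%:E))%E.
  rewrite integralT_nnsfun sintegralE.
  under eq_fsbigr do rewrite hf.
  rewrite -ge0_integral_fsum//; last 2 first.
  - move=> k; apply: emeasurable_funM => //; apply/measurable_EFinP.
    exact: measurable_funM.
  - move=> k x _; rewrite mule_ge0 ?lee_fin//.
    exact: nnfun_muleindic_ge0.
  apply: eq_integral => x _.
  rewrite [in RHS]fimfunE -fsumEFin// ge0_mule_fsuml// => k.
  exact: nnfun_muleindic_ge0.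
transitivity (lim (\int[m]_x (f_ n x)%:E @[n --> \oo])%E).
  rewrite -monotone_convergence//=.
  - by apply: eq_integral => x _; apply/esym/cvg_lim.
  - by move=> k; exact/measurable_EFinP.
  - by move=> k x _; rewrite lee_fin.
  - by move=> x _ ? ? ab; rewrite lee_fin; exact/lefP/nd_nnsfun_approx.
transitivity (lim (\int[n]_x ((f_ k x)%:E * (g x)%:E) @[k --> \oo])%E).
  by apply: congr_lim; apply/funext => k; exact: snn.
rewrite -monotone_convergence//=.
- apply: eq_integral => x _; apply/cvg_lim => //.
  by apply: cvgeMr => //.
- move=> k; apply: emeasurable_funM => //; exact/measurable_EFinP.
- by move=> k x _; rewrite mule_ge0 ?lee_fin.
- move=> x _ a b ab; rewrite lee_wpmul2r ?lee_fin//.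
  exact/lefP/nd_nnsfun_approx.
Qed.

(** The pushforward of Lebesgue measure under the shift gives every interval []b, c]] its length, so
    it is Lebesgue measure by uniqueness. *)
Lemma lebesgue_integral_translation (R : realType) (a : R) (f : R -> \bar R) :
  measurable_fun [set: R] f -> (forall x, (0 <= f x)%E) ->
  (\int[@lebesgue_measure R]_x f (a + x)%R = \int[@lebesgue_measure R]_x f x)%E.
Proof.
move=> mf f0.
pose shift_a (x : measurableTypeR R) : measurableTypeR R := a + x.
have ma : measurable_fun [set: measurableTypeR R] shift_a.
  exact: measurable_funD.
rewrite -(@ge0_integral_pushforward _ _ _ _ _ _ ma lebesgue_measure setT f)//.
apply: eq_measure_integral => A mA _ /=.
apply/esym/(@lebesgue_measure_unique _ (pushforward lebesgue_measure shift_a)) => //=.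
move=> _ [[b c]] _ <-.
rewrite /pushforward.
have -> : shift_a @^-1` `]b, c] = `]b - a, c - a]%classic.
  by apply/seteqP; split=> x /=; rewrite /shift_a !in_itv/= => /andP[? ?];
    apply/andP; split; lra.
rewrite !lebesgue_measure_itv/= !lte_fin ltrD2r -!EFinD.
by have -> : c - a - (b - a) = c - b by ring.
Qed.

(** Takes the measurability proof as an argument and bundles the pushforward as a measure. It is
    transparent, so that it still unfolds to [pushforward m f]. *)
Definition pushforward_measure d d' (T1 : measurableType d)
    (T2 : measurableType d') (R : realType) (m : {measure set T1 -> \bar R})
    (f : T1 -> T2) (mf : measurable_fun [set: T1] f) :
  {measure set T2 -> \bar R}.
Proof. by refine (pushforward m f : {measure set T2 -> \bar R}). Defined.

(** * Iterated Lebesgue integral and Laplace densities *)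

Section leb_int_theory.
Context {R : realType}.
Local Notation leb := (@lebesgue_measure R).

(* Lebesgue measure lives on [measurableTypeR R]: same sigma-algebra as [R],
   but another display, so the two products with [n.-tuple R] do not unify. *)
Lemma measurable_cons_tuple n :
  measurable_fun [set: measurableTypeR R * n.-tuple R]
    (fun p => cons_tuple p.1 p.2 : n.+1.-tuple R).
Proof. exact: measurable_cons. Qed.

(** Represents the iterated integral by a genuine measure, which gives access to Tonelli and
    monotone convergence. The inductive step pushes the product of Lebesgue measure and [L] forward
    along [cons_tuple]; sigma-finiteness is carried along because the next product requires it. *)
Lemma leb_int_measure n : exists L : {sigma_finite_measure set (n.-tuple R) -> \bar R},
  forall f : n.-tuple R -> \bar R, measurable_fun [set: n.-tuple R] f ->
    (forall x, (0 <= f x)%E) -> (\int[L]_x f x)%E = leb_int n f.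
Proof.
elim: n => [|n [L LE]].
  (* In dimension 0 the integral is evaluation at the empty tuple, hence a Dirac mass. *)
  exists (@dirac _ (0.-tuple R) [tuple] R) => f mf f0 /=.
  by rewrite integral_dirac// diracT mul1e.
pose phi (p : measurableTypeR R * n.-tuple R) : n.+1.-tuple R := cons_tuple p.1 p.2.
have mphi : measurable_fun [set: measurableTypeR R * n.-tuple R] phi.
  exact: measurable_cons_tuple.
pose psi (t : n.+1.-tuple R) : measurableTypeR R * n.-tuple R :=
  (thead t, [tuple of behead t]).
have mpsi : measurable_fun [set: n.+1.-tuple R] psi.
  apply: measurable_fun_pair; first exact: measurable_tnth.
  exact: measurable_behead.
pose leb' : {sigma_finite_measure set (measurableTypeR R) -> \bar R} := leb.
pose m : {measure set (measurableTypeR R * n.-tuple R)%type -> \bar R} := (leb' \x L)%E.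
pose nu := pushforward_measure m mphi.
have phiK : cancel phi psi.
  move=> [x t]; rewrite /phi /psi/=; congr pair.
  exact: val_inj.
have sf : sigma_finite [set: n.+1.-tuple R] nu.
  have /sigma_finiteP[F [FT ndF Foo]] := sigma_finiteT leb'.
  have /sigma_finiteP[G [GT ndG Goo]] := sigma_finiteT L.
  (* Rectangles from two exhausting sequences, transported by the inverse [psi] of [phi]. Both
     sequences increase, so the larger of two indices covers a given point, and [psi \o phi = idfun]
     reduces the measure to that of the rectangle. *)
  exists (fun k => psi @^-1` (F k `*` G k)).
    apply/seteqP; split=> // t _.
    have [i _ Fi] : (\bigcup_i F i) (psi t).1 by rewrite -FT.
    have [j _ Gj] : (\bigcup_i G i) (psi t).2 by rewrite -GT.
    exists (maxn i j) => //; split.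
      by move: Fi; exact/subsetPset/ndF/leq_maxl.
    by move: Gj; exact/subsetPset/ndG/leq_maxr.
  move=> k; have [mF Fk] := Foo k; have [mG Gk] := Goo k.
  have mFG : measurable (F k `*` G k) by exact: measurableX.
  split; first by rewrite -[X in measurable X]setTI; exact: mpsi.
  rewrite /nu/= /pushforward -comp_preimage (_ : psi \o phi = idfun)//; last exact/funext.
  by rewrite preimage_id product_measure1E// lte_mul_pinfty// ge0_fin_numE.
pose S := Measure_isSigmaFinite.Build _ _ _ nu sf.
pose nu' : {sigma_finite_measure set (n.+1.-tuple R) -> \bar R} :=
  HB.pack (nu : set _ -> \bar R) (Measure.class nu) S.
exists nu' => f mf f0.
rewrite (_ : \int[nu']_x f x = \int[pushforward m phi]_x f x)%E//.
rewrite ge0_integral_pushforward//= fubini_tonelli1//=; last first.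
  exact: measurableT_comp.
apply: eq_integral => x _; rewrite /fubini_F/= LE//.
apply: (@measurableT_comp _ _ _ _ _ _ f _
  (fun t : n.-tuple R => cons_tuple (x : R) t)) => //.
exact: measurable_cons.
Qed.

End leb_int_theory.

(** * Translation invariance and Laplace densities *)

Section laplace.
Context {R : realType}.
Local Notation leb := (@lebesgue_measure R).

Lemma vadd_cons n (a : n.+1.-tuple R) x (t : n.-tuple R) :
  vadd a (cons_tuple x t) =
  cons_tuple (tnth a ord0 + x) (vadd [tuple tnth a (lift ord0 i) | i < n] t).
Proof.
apply: eq_from_tnth => i; rewrite tnth_mktuple.
case: (unliftP ord0 i) => [j|] ->; last by [].
by rewrite !tnthS !tnth_mktuple.
Qed.

Lemma measurable_vadd2 n :
  measurable_fun [set: n.-tuple R * n.-tuple R] (fun p => vadd p.1 p.2).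
Proof.
apply/measurable_fun_tnthP => i.
rewrite (_ : _ \o _ = fun p => tnth p.1 i + tnth p.2 i); last first.
  by apply/funext => p /=; rewrite tnth_mktuple.
apply: measurable_funD.
  apply: (@measurableT_comp _ _ _ _ _ _ (fun x : n.-tuple R => tnth x i)) => //.
  exact: measurable_tnth.
apply: (@measurableT_comp _ _ _ _ _ _ (fun x : n.-tuple R => tnth x i)) => //.
exact: measurable_tnth.
Qed.

Lemma measurable_vaddr n (a : n.-tuple R) :
  measurable_fun [set: n.-tuple R] (fun x => vadd a x).
Proof.
apply: (@measurableT_comp _ _ _ _ _ _ (fun p => vadd p.1 p.2) _ (pair a)) => //.
exact: measurable_vadd2.
Qed.

Lemma leb_int_ge0 n (f : n.-tuple R -> \bar R) :
  (forall x, (0 <= f x)%E) -> (0 <= leb_int n f)%E.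
Proof.
elim: n f => [f f0|n IH f f0] /=; first exact: f0.
by apply: integral_ge0 => x _; apply: IH.
Qed.

(** The inner integral is a section integral against the measure [L], so Tonelli gives its
    measurability in the first coordinate. *)
Lemma measurable_leb_int_cons n (f : n.+1.-tuple R -> \bar R) :
  measurable_fun [set: n.+1.-tuple R] f -> (forall x, (0 <= f x)%E) ->
  measurable_fun [set: R] (fun x : R => leb_int n (fun t => f (cons_tuple x t))).
Proof.
move=> mf f0; have [L LE] := @leb_int_measure R n.
have mcons (x : R) : measurable_fun [set: n.-tuple R] (fun t => f (cons_tuple x t)).
  apply: (@measurableT_comp _ _ _ _ _ _ f _ (fun t : n.-tuple R => cons_tuple x t)) => //.
  exact: measurable_cons.
rewrite (_ : (fun x => _) =
  fubini_F L (fun p : R * n.-tuple R => f (cons_tuple p.1 p.2))).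
  apply: measurable_fun_fubini_tonelli_F => //.
  apply: (@measurableT_comp _ _ _ _ _ _ f _
    (fun p : R * n.-tuple R => cons_tuple p.1 p.2)) => //.
  exact: measurable_cons.
by apply/funext => x; rewrite /fubini_F/= LE.
Qed.

(** By induction: the first coordinate is shifted by the one-dimensional invariance, the remaining
    ones by the induction hypothesis. *)
Lemma leb_int_translation n (a : n.-tuple R) (f : n.-tuple R -> \bar R) :
  measurable_fun [set: n.-tuple R] f -> (forall x, (0 <= f x)%E) ->
  leb_int n (fun x => f (vadd a x)) = leb_int n f.
Proof.
elim: n a f => [|n IH] a f mf f0 /=; first by congr f; apply: eq_from_tnth => -[].
rewrite -(@lebesgue_integral_translation _ (tnth a ord0)
  (fun x => leb_int n (fun t => f (cons_tuple x t)))); last 2 first.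
- exact: measurable_leb_int_cons.
- by move=> x; apply: leb_int_ge0.
apply: eq_integral => x _; under eq_fun do rewrite vadd_cons.
rewrite (IH _ (fun t => f (cons_tuple (tnth a ord0 + x) t)))//.
apply: (@measurableT_comp _ _ _ _ _ _ f) => //.
exact: measurable_cons.
Qed.

(** The l1 norm makes [laplace] a product over coordinates, so that its total mass follows from a
    one-dimensional integral. *)
Definition l1norm n (x : n.-tuple R) : R := \sum_(i < n) `|tnth x i|.

Definition laplace n (s : R) (x : n.-tuple R) : R :=
  expR (- (l1norm x / s)) / (2 * s) ^+ n.

Lemma l1norm_ge0 n (x : n.-tuple R) : 0 <= l1norm x.
Proof. by apply: sumr_ge0. Qed.

Lemma ler_l1normD n (x y : n.-tuple R) : l1norm (vadd x y) <= l1norm x + l1norm y.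
Proof.
rewrite -big_split/=; apply: ler_sum => i _; rewrite tnth_mktuple.
exact: ler_normD.
Qed.

Lemma measurable_l1norm n : measurable_fun [set: n.-tuple R] (@l1norm n).
Proof.
apply: measurable_sum => i; apply: measurableT_comp => //.
exact: measurable_tnth.
Qed.

Lemma measurable_laplace n s : measurable_fun [set: n.-tuple R] (laplace s).
Proof.
apply: measurable_funM => //; apply: measurableT_comp => //.
apply: measurableT_comp => //; apply: measurable_funM => //.
exact: measurable_l1norm.
Qed.

Lemma laplace_gt0 n s (x : n.-tuple R) : 0 < s -> 0 < laplace s x.
Proof.
by move=> s0; rewrite /laplace divr_gt0 ?expR_gt0// exprn_gt0// mulr_gt0.
Qed.

Lemma laplace_ge0 n s (x : n.-tuple R) : 0 < s -> 0 <= laplace s x.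
Proof. by move=> s0; exact/ltW/laplace_gt0. Qed.

Lemma laplace_cons n s (x : R) (t : n.-tuple R) :
  laplace s (cons_tuple x t) = expR (- (`|x| / s)) / (2 * s) * laplace s t.
Proof.
rewrite /laplace /l1norm big_ord_recl.
under eq_bigr do rewrite tnthS.
rewrite (_ : tnth _ ord0 = x)// mulrDl opprD expRD exprS invfM; ring.
Qed.

Lemma integral_expRN_itvcy (r : R) : 0 < r ->
  (\int[leb]_(x in `[0%R, +oo[) (r * expR (- r * x))%:E = 1)%E.
Proof.
move=> r0; rewrite -(integral_exponential_pdf r0) integral_mkcond.
by apply: eq_integral => x _; rewrite /exponential_pdf !patchE; case: ifP.
Qed.

(** The integrand is even, and twice its restriction to the half-line is the exponential density of
    rate 1/s. *)
Lemma integral_exp_abs (s : R) : 0 < s ->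
  (\int[leb]_x (expR (- (`|x| / s)) / (2 * s))%:E = 1)%E.
Proof.
move=> s0.
have cf : continuous (fun x : R => expR (- (`|x| / s)) / (2 * s)).
  move=> x; apply: cvgM; last exact: cvg_cst.
  apply: continuous_comp; last exact: continuous_expR.
  apply: continuousN; apply: cvgM; last exact: cvg_cst.
  exact: norm_continuous.
rewrite ge0_symfun_integralT//; last 2 first.
- by move=> x; rewrite divr_ge0 ?expR_ge0// mulr_ge0// ltW.
- by move=> x /=; rewrite normrN.
have -> : [set x : R | 0 <= x] = `[0, +oo[%classic.
  by apply/seteqP; split=> x /=; rewrite in_itv/= andbT.
have is0 : 0 < s^-1 by rewrite invr_gt0.
rewrite -(integral_expRN_itvcy is0) -ge0_integralZl//=; last 2 first.
- by apply/measurable_EFinP/measurable_funTS; exact: continuous_measurable_fun.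
- by move=> x _; rewrite lee_fin divr_ge0 ?expR_ge0// mulr_ge0// ltW.
apply: eq_integral => x; rewrite inE/= in_itv/= andbT => x0.
rewrite -EFinM; congr EFin; rewrite ger0_norm// mulNr [s^-1 * x]mulrC.
by field; rewrite gt_eqF.
Qed.

Lemma leb_int_laplace n s : 0 < s ->
  leb_int n (fun x => (laplace s x)%:E) = 1%E.
Proof.
move=> s0; elim: n => [|n IH] /=.
  by rewrite /laplace /l1norm big_ord0 mul0r oppr0 expR0 expr0 divr1.
rewrite -[RHS](integral_exp_abs s0); apply: eq_integral => x _.
have [L LE] := @leb_int_measure R n.
have mq : measurable_fun [set: n.-tuple R] (EFin \o laplace s).
  by apply/measurable_EFinP; exact: measurable_laplace.
under eq_fun do rewrite laplace_cons EFinM.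
rewrite -LE; last 2 first.
- exact: emeasurable_funM.
- move=> t; apply: mule_ge0; rewrite lee_fin; last exact: laplace_ge0.
  by rewrite divr_ge0 ?expR_ge0// mulr_ge0// ltW.
rewrite ge0_integralZl//; last 2 first.
- by move=> t _; rewrite lee_fin laplace_ge0.
- by rewrite lee_fin divr_ge0 ?expR_ge0// mulr_ge0// ltW.
rewrite LE// ?IH ?mule1// => t.
by rewrite lee_fin laplace_ge0.
Qed.

End laplace.

(** * Additive-noise channels *)

(** [distribution] expects a bundled measurable function; here it is assembled from [f] and its
    measurability proof. The result is convertible to the pushforwards in [MI_additive]. *)
Definition pushforward_probability d d' (T1 : measurableType d)
    (T2 : measurableType d') (R : realType) (P : probability T1 R)
    (f : T1 -> T2) (mf : measurable_fun [set: T1] f) : probability T2 R :=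
  let X := HB.pack_for {mfun T1 >-> T2} f (isMeasurableFun.Build _ _ _ _ f mf) in
  distribution P X.

Lemma measurable_inv_gt0 d (T : measurableType d) (R : realType) (f : T -> R) :
  (forall x, 0 < f x) -> measurable_fun [set: T] f ->
  measurable_fun [set: T] (fun x => (f x)^-1).
Proof.
move=> f0 mf; rewrite (_ : (fun x => _) = (powR (R := R))^~ (-1) \o f).
  by apply: measurableT_comp => //; exact: measurable_powR.
by apply/funext => x /=; rewrite powR_inv1// ltW.
Qed.

Section additive_channel.
Context {R : realType} {n : nat}.
Local Notation T := (n.-tuple R).

Definition vsub (y x : T) : T := [tuple tnth y i - tnth x i | i < n].

Lemma vaddK (x z : T) : vsub (vadd x z) x = z.
Proof. by apply: eq_from_tnth => i; rewrite !tnth_mktuple addrC addKr. Qed.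

Lemma measurable_vsub2 : measurable_fun [set: T * T] (fun p => vsub p.2 p.1).
Proof.
apply/measurable_fun_tnthP => i.
rewrite (_ : _ \o _ = fun p => tnth p.2 i - tnth p.1 i); last first.
  by apply/funext => p /=; rewrite tnth_mktuple.
apply: measurable_funB.
  apply: (@measurableT_comp _ _ _ _ _ _ (fun x : T => tnth x i)) => //.
  exact: measurable_tnth.
apply: (@measurableT_comp _ _ _ _ _ _ (fun x : T => tnth x i)) => //.
exact: measurable_tnth.
Qed.

Variable L : {sigma_finite_measure set T -> \bar R}.
Hypothesis LE : forall g : T -> \bar R, measurable_fun [set: T] g ->
  (forall x, (0 <= g x)%E) -> (\int[L]_x g x)%E = leb_int n g.
Variables (PX mu : probability T R) (f : T -> R) (C : R).
Hypothesis mf : measurable_fun [set: T] f.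
Hypothesis f_gt0 : forall x, 0 < f x.
Hypothesis f_le : forall x, f x <= C.
Hypothesis muE : forall A, measurable A -> mu A = (\int[L]_(x in A) (f x)%:E)%E.

Lemma measurable_joint :
  measurable_fun [set: T * T] (fun p => (p.1, vadd p.1 p.2)).
Proof. by apply: measurable_fun_pair => //; exact: measurable_vadd2. Qed.

Definition joint_law := pushforward_probability (PX \x mu)%E measurable_joint.

Definition output_law := pushforward_probability (PX \x mu)%E (@measurable_vadd2 R n).

(** The density of X + N, an average of translates of [f]. The bound [f <= C] keeps the integral
    finite, so [fine] loses nothing. *)
Definition output_density (y : T) : R := fine (\int[PX]_x (f (vsub y x))%:E)%E.

Let PXT : PX [set: T] = 1%E. Proof. exact: probability_setT. Qed.

Let mfsub : measurable_fun [set: T * T] (fun p => (f (vsub p.2 p.1))%:E).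
Proof.
apply/measurable_EFinP; apply: measurableT_comp => //; exact: measurable_vsub2.
Qed.

Let mfsubx y : measurable_fun [set: T] (fun x => (f (vsub y x))%:E).
Proof.
exact: (measurableT_comp mfsub (pair2_measurable y)).
Qed.

Let mfsuby x : measurable_fun [set: T] (fun y => (f (vsub y x))%:E).
Proof.
exact: (measurableT_comp mfsub (pair1_measurable x)).
Qed.

Lemma output_densityE y : (output_density y)%:E = (\int[PX]_x (f (vsub y x))%:E)%E.
Proof.
rewrite fineK// ge0_fin_numE; last first.
  by apply: integral_ge0 => x _; rewrite lee_fin ltW.
apply: (@le_lt_trans _ _ (\int[PX]_x (cst C%:E x))%E).
  apply: ge0_le_integral => //.
  - by move=> x _; rewrite lee_fin ltW.
  - by move=> x _; rewrite lee_fin.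
by rewrite integral_cst// [X in (_ * X)%E]PXT mule1 ltry.
Qed.

(** If the average of the positive function [f (vsub y x)] were 0, that function would vanish almost
    everywhere; the exceptional null set would then be the whole space, which has mass 1. *)
Lemma output_density_gt0 y : 0 < output_density y.
Proof.
rewrite lt_neqAle; apply/andP; split; last first.
  by rewrite fine_ge0//; apply: integral_ge0 => x _; rewrite lee_fin ltW.
apply/eqP => b0; have := output_densityE y; rewrite -b0 => /esym I0.
have : ae_eq PX setT (fun x => (f (vsub y x))%:E) (cst 0%E).
  apply/ae_eq_integral_abs => //.
  rewrite -[RHS]I0; apply: eq_integral => x _.
  by rewrite gee0_abs ?lee_fin// ltW.
move=> [N [mN N0 sub]].
suff NT : N = setT.
  suff /eqP : (1 = 0 :> \bar R)%E by rewrite onee_eq0.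
  by rewrite -PXT -NT; exact: N0.
apply/seteqP; split=> // x _; apply: sub => /= /(_ I) [] fx0.
by have := f_gt0 (vsub y x); rewrite fx0 ltxx.
Qed.

Lemma measurable_output_density : measurable_fun [set: T] output_density.
Proof.
apply/measurable_EFinP.
rewrite (_ : _ \o _ = fubini_G PX (fun p => (f (vsub p.2 p.1))%:E)).
  apply: measurable_fun_fubini_tonelli_G => //.
  by move=> p; rewrite lee_fin ltW.
by apply/funext => y; rewrite /= output_densityE.
Qed.

(** For fixed x the noise variable z is replaced by y = x + z, which is legitimate by translation
    invariance of [leb_int]. *)
Lemma integral_joint (F : T * T -> \bar R) :
  measurable_fun [set: T * T] F -> (forall p, (0 <= F p)%E) ->
  (\int[joint_law]_p F p =
   \int[PX]_x \int[L]_y (F (x, y) * (f (vsub y x))%:E))%E.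
Proof.
move=> mF F0; rewrite (ge0_integral_pushforward measurable_joint)//= preimage_setT.
have mFx x : measurable_fun [set: T] (fun y => F (x, y)).
  exact: (measurableT_comp mF (pair1_measurable x)).
rewrite fubini_tonelli1//=; last first.
  exact: (@measurableT_comp _ _ _ _ _ _ _ _ _ mF measurable_joint).
apply: eq_integral => x _; rewrite /fubini_F/=.
rewrite (ge0_integral_density mf _ muE); last 3 first.
- by move=> z; exact/ltW.
- exact: (measurableT_comp (mFx x) (measurable_vaddr x)).
- by [].
rewrite [RHS]LE; last 2 first.
- exact: emeasurable_funM.
- by move=> y; rewrite mule_ge0// lee_fin ltW.
(* Shifting the right-hand side by x turns [vsub y x] into [vsub (vadd x z) x], which is z. *)
rewrite -(leb_int_translation x); last 2 first.
- exact: emeasurable_funM.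
- by move=> y; rewrite mule_ge0// lee_fin ltW.
rewrite -LE; last 2 first.
- apply: (@measurableT_comp _ _ _ _ _ _ (fun y => F (x, y) * (f (vsub y x))%:E)%E).
    exact: emeasurable_funM.
  exact: measurable_vaddr.
- by move=> y; rewrite mule_ge0// lee_fin ltW.
by apply: eq_integral => z _; rewrite vaddK.
Qed.

Lemma integral_joint_snd (h : T -> \bar R) :
  measurable_fun [set: T] h -> (forall y, (0 <= h y)%E) ->
  (\int[joint_law]_p h p.2 = \int[output_law]_y h y)%E.
Proof.
move=> mh h0.
rewrite (ge0_integral_pushforward measurable_joint)//=; last first.
  exact: (measurableT_comp mh).
by rewrite (ge0_integral_pushforward (@measurable_vadd2 R n)).
Qed.

(** [integral_joint] applied to an indicator of y, followed by an exchange of the two integrals. *)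
Lemma output_lawE A : measurable A ->
  output_law A = (\int[L]_(y in A) (output_density y)%:E)%E.
Proof.
move=> mA; have mI : measurable_fun [set: T] (EFin \o \1_A : T -> \bar R).
  exact/measurable_EFinP.
have -> : output_law A = (\int[output_law]_y (EFin \o \1_A) y)%E.
  by rewrite integral_indic// setIT.
rewrite -integral_joint_snd//; last by move=> y; rewrite lee_fin.
rewrite integral_joint; last 2 first.
- exact: (measurableT_comp mI).
- by move=> p; rewrite lee_fin.
rewrite (@fubini_tonelli _ _ _ _ _ PX L
  (fun p => ((EFin \o \1_A) p.2 * (f (vsub p.2 p.1))%:E)%E)); last 2 first.
- by apply: emeasurable_funM => //; exact: (measurableT_comp mI).
- by move=> p; rewrite mule_ge0// lee_fin// ltW.
rewrite [RHS]integral_mkcond epatch_indic; apply: eq_integral => y _ /=.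
rewrite ge0_integralZl//; last first.
  by move=> x _; rewrite lee_fin ltW.
by rewrite output_densityE muleC.
Qed.

Lemma integral_output (h : T -> \bar R) :
  measurable_fun [set: T] h -> (forall y, (0 <= h y)%E) ->
  (\int[output_law]_y h y = \int[L]_y (h y * (output_density y)%:E))%E.
Proof.
move=> mh h0; apply: (ge0_integral_density measurable_output_density) => //.
  by move=> y; exact/ltW/output_density_gt0.
exact: output_lawE.
Qed.

Definition joint_density (p : T * T) : R :=
  f (vsub p.2 p.1) / output_density p.2.

Lemma joint_density_gt0 p : 0 < joint_density p.
Proof. by rewrite divr_gt0// output_density_gt0. Qed.

Lemma measurable_joint_density : measurable_fun [set: T * T] joint_density.
Proof.
apply: measurable_funM; first exact/measurable_EFinP.
apply: measurable_inv_gt0 => [p|]; first exact: output_density_gt0.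
exact: (measurableT_comp measurable_output_density).
Qed.

(** Tested on indicators: integrating against [output_law] contributes the factor
    [output_density y], which cancels the denominator of [joint_density]. *)
Lemma joint_law_density : is_density (PX \x output_law)%E joint_law joint_density.
Proof.
have mg : measurable_fun [set: T * T] (EFin \o joint_density).
  by apply/measurable_EFinP; exact: measurable_joint_density.
split; [exact: measurable_joint_density|by move=> p; exact/ltW/joint_density_gt0|].
move=> A mA; have mI : measurable_fun [set: T * T] (EFin \o \1_A : T * T -> \bar R).
  exact/measurable_EFinP.
have -> : joint_law A = (\int[joint_law]_y (EFin \o \1_A) y)%E.
  by rewrite integral_indic// setIT.
rewrite integral_joint//; last by move=> p; rewrite lee_fin.
rewrite [RHS]integral_mkcond epatch_indic fubini_tonelli1//=; last 2 first.
- exact: emeasurable_funM.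
- by move=> p; rewrite mule_ge0// lee_fin// ltW// joint_density_gt0.
apply: eq_integral => x _; rewrite /fubini_F integral_output; last 2 first.
- exact: (measurableT_comp (emeasurable_funM mg mI) (pair1_measurable x)).
- by move=> p; rewrite mule_ge0// lee_fin// ltW// joint_density_gt0.
apply: eq_integral => y _; rewrite /= -!EFinM /joint_density/=; congr EFin.
by field; rewrite gt_eqF// output_density_gt0.
Qed.

(** * Upper bound on the mutual information *)

Section upper.
Variables (q h : T -> R).
Hypothesis mq : measurable_fun [set: T] q.
Hypothesis mh : measurable_fun [set: T] h.
Hypothesis q_gt0 : forall y, 0 < q y.
Hypothesis h_ge0 : forall y, 0 <= h y.
Hypothesis q_le1 : (\int[L]_y (q y)%:E <= 1)%E.
Hypothesis hq : forall y, ln (C / q y) <= h y.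

(** The infimum in [KL] is at most its value at [joint_density]. Working with a nonnegative majorant
    [h] of ln(C/q) keeps every integral on the right one of a nonnegative function. *)
Lemma MI_additive_le :
  (MI_additive PX mu <= \int[joint_law]_p (h p.2)%:E + 1)%E.
Proof.
have b_gt0 := output_density_gt0.
have mqb : measurable_fun [set: T] (fun y => q y / output_density y).
  apply: measurable_funM => //; apply: measurable_inv_gt0 => //.
  exact: measurable_output_density.
apply: (@le_trans _ _ (\int[PX \x output_law]_p
    (joint_density p * ln (joint_density p))%:E)%E).
  apply: ereal_inf_lbound; right; exists joint_density => //.
  exact: joint_law_density.
pose G p := ((h p.2)%:E * (joint_density p)%:E +
  (q p.2 / output_density p.2)%:E * (joint_density p)%:E)%E.
have mg := measurable_joint_density.
have mEg : measurable_fun [set: T * T] (EFin \o joint_density) by exact/measurable_EFinP.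
have mh2 : measurable_fun [set: T * T] (fun p => (h p.2)%:E).
  by apply/measurable_EFinP; exact: measurableT_comp.
have mqb2 : measurable_fun [set: T * T] (fun p => (q p.2 / output_density p.2)%:E).
  by apply/measurable_EFinP; exact: (measurableT_comp mqb).
have g0 p := ltW (joint_density_gt0 p).
have qb0 y : 0 <= q y / output_density y by rewrite divr_ge0// ltW.
have [_ _ gE] := joint_law_density.
apply: (@le_trans _ _ (\int[PX \x output_law]_p G p)%E).
  apply: le_integral_measurable.
  - apply/measurable_EFinP; apply: measurable_funM => //; exact: measurableT_comp.
  - by apply: emeasurable_funD; apply: emeasurable_funM.
  (* After factoring out g = [joint_density], the claim is ln g <= h + q/b with b the output
     density. It follows from g = (f/q)(q/b), ln(f/q) <= ln(C/q) <= h and ln t <= t. *)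
  move=> [x y]; rewrite /G/= -!EFinM -EFinD lee_fin -mulrDl mulrC ler_wpM2r//.
  rewrite /joint_density/=.
  have -> : f (vsub y x) / output_density y =
      (f (vsub y x) / q y) * (q y / output_density y).
    by field; rewrite !gt_eqF.
  rewrite lnM ?posrE ?divr_gt0//; apply: lerD; last first.
    by apply/ltW/ln_sublinear; rewrite divr_gt0.
  apply: le_trans (hq y); rewrite ler_ln ?posrE ?divr_gt0//.
    by rewrite ler_pM2r ?invr_gt0.
  exact: lt_le_trans (f_gt0 (vsub y x)) _.
rewrite /G ge0_integralD//; last 4 first.
- by move=> p _; rewrite mule_ge0 ?lee_fin.
- exact: emeasurable_funM.
- by move=> p _; rewrite mule_ge0 ?lee_fin.
- exact: emeasurable_funM.
rewrite -(ge0_integral_density mg g0 gE)//; last by move=> p; rewrite lee_fin.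
rewrite -(ge0_integral_density mg g0 gE)//; last by move=> p; rewrite lee_fin.
rewrite leeD2l//.
rewrite (integral_joint_snd (h := fun y => (q y / output_density y)%:E)); last 2 first.
- exact/measurable_EFinP.
- by move=> y; rewrite lee_fin.
rewrite integral_output; last 2 first.
- exact/measurable_EFinP.
- by move=> y; rewrite lee_fin.
(* The output density cancels and leaves the integral of [q]. *)
apply: le_trans q_le1; rewrite le_eqVlt; apply/orP; left; apply/eqP.
by apply: eq_integral => y _; rewrite -EFinM divfK// gt_eqF.
Qed.

End upper.

End additive_channel.

(** * Laws with a given density and a variational bound for the divergence *)

Lemma exists_probability_density d (T : measurableType d) (R : realType)
    (m : {measure set T -> \bar R}) (g : T -> R) :
  measurable_fun [set: T] g -> (forall x, 0 <= g x) ->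
  (\int[m]_x (g x)%:E = 1)%E ->
  exists P : probability T R, forall A, measurable A ->
    P A = (\int[m]_(x in A) (g x)%:E)%E.
Proof.
move=> mg g0 g1; have mEg : measurable_fun [set: T] (EFin \o g).
  exact/measurable_EFinP.
pose P (A : set T) := (\int[m]_(x in A) (g x)%:E)%E.
have P0 : P set0 = 0%E by rewrite /P integral_set0.
have Pge0 A : (0 <= P A)%E by apply: integral_ge0 => x _; rewrite lee_fin.
have Psa : semi_sigma_additive P.
  move=> A mA tA mUA; rewrite /P ge0_integral_bigcup//.
  - by apply: is_cvg_ereal_nneg_natsum_cond => k _ _; exact: Pge0.
  - exact: measurable_funTS.
  - by move=> x _; rewrite lee_fin.
pose M := isMeasure.Build _ _ _ P P0 Pge0 Psa.
pose P' : {measure set T -> \bar R} := HB.pack P M.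
pose Q := Measure_isProbability.Build _ _ _ P' g1.
pose P'' : probability T R := HB.pack P P' Q.
by exists P''.
Qed.

(* Donsker-Varadhan: t ln t >= t w - e^(w-1), used with w = 1 + ln k - W. *)
Lemma KL_ge d (T : measurableType d) (R : realType) (P : probability T R)
    (Q : {measure set T -> \bar R}) (W : T -> R) (k : R) : 1 <= k ->
  measurable_fun [set: T] W -> (forall x, 0 <= W x) ->
  (\int[P]_x (W x)%:E < +oo)%E ->
  (\int[Q]_x (k * expR (- W x))%:E <= 1)%E ->
  ((ln k)%:E - \int[P]_x (W x)%:E <= KL P Q)%E.
Proof.
move=> k1 mW W0 Woo kW; apply: le_ereal_inf_tmp => _ [->|[g [mg g0 gE] <-]].
  by rewrite leey.
have k0 : 0 < k by exact: lt_le_trans k1.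
(* This is where [1 <= k] enters: it makes [F] below nonnegative. *)
have c0 : 0 <= 1 + ln k by rewrite addr_ge0 ?ln_ge0.
have mEg : measurable_fun [set: T] (EFin \o g) by exact/measurable_EFinP.
have mEW : measurable_fun [set: T] (EFin \o W) by exact/measurable_EFinP.
have mK : measurable_fun [set: T] (fun x => (k * expR (- W x))%:E).
  apply/measurable_EFinP; apply: measurable_funM => //.
  by apply: measurableT_comp => //; exact: measurableT_comp.
have K0 x : (0 <= (k * expR (- W x))%:E)%E by rewrite lee_fin mulr_ge0 ?expR_ge0 ?ltW.
have mWg : measurable_fun [set: T] (fun x => (W x)%:E * (g x)%:E)%E.
  exact: emeasurable_funM.
have Wg0 x : (0 <= (W x)%:E * (g x)%:E)%E by rewrite mule_ge0 ?lee_fin.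
(* With this w, e^(w-1) = k e^(-W), so the lower bound g w - e^(w-1) equals F - G. Both parts are
   nonnegative with finite integral, hence the integral of the difference splits. *)
pose F x := ((1 + ln k)%:E * (g x)%:E)%E.
pose G x := ((W x)%:E * (g x)%:E + (k * expR (- W x))%:E)%E.
have mF : measurable_fun [set: T] F by exact: emeasurable_funM.
have mG : measurable_fun [set: T] G by exact: emeasurable_funD.
have F0 x : (0 <= F x)%E by rewrite mule_ge0 ?lee_fin.
have G0 x : (0 <= G x)%E by rewrite adde_ge0.
have IF : (\int[Q]_x F x = (1 + ln k)%:E)%E.
  rewrite ge0_integralZl//; last by move=> x _; rewrite lee_fin.
  rewrite -[X in (_ * X)%E]gE// [X in (_ * X)%E](_ : _ = 1%E) ?mule1//.
  exact: probability_setT.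
have IG : (\int[Q]_x G x <= \int[P]_x (W x)%:E + 1)%E.
  by rewrite ge0_integralD// -(ge0_integral_density mg g0 gE)// leeD2l.
have iF : Q.-integrable setT F.
  apply/integrableP; split=> //; under eq_integral do rewrite gee0_abs//.
  by rewrite IF ltry.
have iG : Q.-integrable setT G.
  apply/integrableP; split=> //; under eq_integral do rewrite gee0_abs//.
  by apply: le_lt_trans IG _; rewrite lte_add_pinfty// ltry.
apply: (@le_trans _ _ (\int[Q]_x (F x - G x))%E).
  rewrite integralB// IF.
  apply: (@le_trans _ _ ((1 + ln k)%:E - (\int[P]_x (W x)%:E + 1))%E); last first.
    exact: leeB.
  have Wfin : (\int[P]_x (W x)%:E)%E \is a fin_num.
    by rewrite ge0_fin_numE// integral_ge0// => x _; rewrite lee_fin.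
  by rewrite -(fineK Wfin) -EFinD -!EFinB lee_fin; lra.
apply: le_integral_measurable.
- exact: emeasurable_funB.
- apply/measurable_EFinP; apply: measurable_funM => //; exact: measurableT_comp.
move=> x; rewrite /F /G -!EFinM -[X in (_ - X)%E]EFinD -EFinB lee_fin.
(* Where g vanishes, the right-hand side is 0 and the left-hand side is -k e^(-W). *)
have [gx|gx] := eqVneq (g x) 0.
  rewrite gx !mulr0 mul0r !add0r oppr_le0; exact: K0.
have gx0 : 0 < g x by rewrite lt_neqAle eq_sym gx g0.
(* The inequality ln t <= t - 1 at t = k e^(-W)/g, to be multiplied by g. *)
have : ln (k * expR (- W x) / g x) <= k * expR (- W x) / g x - 1.
  rewrite -[X in ln X](subrK 1) [_ - 1 + 1]addrC; apply: le_ln1Dx.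
  by rewrite ltrBrDl subrr divr_gt0// mulr_gt0// expR_gt0.
rewrite ln_div ?posrE ?mulr_gt0 ?expR_gt0// lnM ?posrE ?expR_gt0// expRK.
move=> H; have := ler_wpM2r (ltW gx0) H.
rewrite [X in _ <= X]mulrBl mul1r divfK//; set K := k * _; lra.
Qed.

(** * Norm comparisons and the second moment of the Laplace density *)

Section channel_bounds.
Context {R : realType} {n : nat}.
Local Notation T := (n.-tuple R).
Variable L : {sigma_finite_measure set T -> \bar R}.
Hypothesis LE : forall g : T -> \bar R, measurable_fun [set: T] g ->
  (forall x, (0 <= g x)%E) -> (\int[L]_x g x)%E = leb_int n g.

Lemma integral_laplace s : 0 < s -> (\int[L]_x (laplace s x)%:E = 1)%E.
Proof.
move=> s0; rewrite LE ?leb_int_laplace//.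
  by apply/measurable_EFinP; exact: measurable_laplace.
by move=> x; rewrite lee_fin laplace_ge0.
Qed.

Lemma measurable_sqnorm : measurable_fun [set: T] (@sqnorm R n).
Proof.
apply: measurable_sum => i; apply: (measurable_funX 2).
exact: measurable_tnth.
Qed.

Lemma sqnorm_ge0 (x : T) : 0 <= sqnorm x.
Proof. by apply: sumr_ge0 => i _; rewrite sqr_ge0. Qed.

Lemma sqnorm_le_l1norm (x : T) : sqnorm x <= l1norm x ^+ 2.
Proof.
rewrite expr2 {1}/l1norm mulr_suml; apply: ler_sum => i _.
rewrite -real_normK ?num_real// expr2 ler_wpM2l//.
by rewrite /l1norm (bigD1 i)//= lerDl sumr_ge0.
Qed.

(** Coordinatewise this is z <= 1 + z^2 for z = |x_i|/s. It converts the power constraint into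
    control of the l1 norm. *)
Lemma l1norm_le_sqnorm s (x : T) : 0 < s ->
  l1norm x / s <= n%:R + sqnorm x / s ^+ 2.
Proof.
move=> s0; rewrite /l1norm /sqnorm !mulr_suml.
rewrite -[n in n%:R]card_ord -sum1_card natr_sum -big_split/=.
apply: ler_sum => i _; set t := tnth x i.
rewrite -[t ^+ 2]real_normK ?num_real// -expr_div_n.
set z := _ / s; nra.
Qed.

(** Half of the decay absorbs the square: for z = |x|_1/s one has z^2/8 <= e^(z/2), and the
    remaining e^(-z/2) is the profile of [laplace (2 * s)]. The factor 2^n compares the
    normalisations. Integration bounds the power of a Laplace input by 8 2^n s^2. *)
Lemma laplace_second_moment s (x : T) : 0 < s ->
  sqnorm x * laplace s x <= 8 * 2 ^+ n * s ^+ 2 * laplace (2 * s) x.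
Proof.
move=> s0.
pose z := l1norm x / s.
have z0 : 0 <= z by rewrite divr_ge0 ?l1norm_ge0// ltW.
have ez : z ^+ 2 / 8 <= expR (z / 2).
  have /(@expR_ge1Dxn _ _ 1) : 0 <= z / 2 by rewrite divr_ge0.
  apply: le_trans; rewrite (_ : z ^+ 2 / 8 = (z / 2) ^+ 2 / 2`!%:R) ?lerDr//.
  by rewrite (_ : 2`!%:R = 2 :> R)//; field.
have sz : sqnorm x <= (z * s) ^+ 2.
  by rewrite divfK ?gt_eqF// sqnorm_le_l1norm.
have -> : laplace (2 * s) x = expR (- (z / 2)) / (2 ^+ n * (2 * s) ^+ n).
  rewrite /laplace -exprMn; congr (expR (- _) / _).
  by rewrite /z invfM; ring.
have -> : laplace s x = expR (- (z / 2)) / expR (z / 2) / (2 * s) ^+ n.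
  by rewrite /laplace -expRN -expRD; congr (expR _ / _); rewrite -/z; lra.
have E0 := expR_gt0 (z / 2); have E1 := expR_gt0 (- (z / 2)).
have D0 : 0 < (2 * s) ^+ n by rewrite exprn_gt0// mulr_gt0.
rewrite [X in _ <= X](_ : _ = 8 * s ^+ 2 * expR (- (z / 2)) / (2 * s) ^+ n); last first.
  by field; rewrite !gt_eqF// exprn_gt0.
rewrite mulrA ler_pM2r ?invr_gt0// mulrCA [8 * _ * _]mulrC ler_pM2l//.
rewrite ler_pdivrMr// (le_trans sz)// exprMn.
have s20 : 0 < s ^+ 2 by rewrite exprn_gt0.
nra.
Qed.

End channel_bounds.

(** * Capacity bounds for a bounded noise density with finite first moment *)

Section capacity_bounds.
Context {R : realType} {n : nat}.
Local Notation T := (n.-tuple R).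
Variable L : {sigma_finite_measure set T -> \bar R}.
Hypothesis LE : forall g : T -> \bar R, measurable_fun [set: T] g ->
  (forall x, (0 <= g x)%E) -> (\int[L]_x g x)%E = leb_int n g.
Variables (mu : probability T R) (f : T -> R) (C : R).
Hypothesis mf : measurable_fun [set: T] f.
Hypothesis f_gt0 : forall x, 0 < f x.
Hypothesis f_le : forall x, f x <= C.
Hypothesis C_ge1 : 1 <= C.
Hypothesis muE : forall A, measurable A -> mu A = (\int[L]_(x in A) (f x)%:E)%E.
Variable m : R.
Hypothesis l1_le : (\int[mu]_z (l1norm z)%:E <= m%:E)%E.

Lemma integral_fst (PX : probability T R) (h : T -> \bar R) :
  measurable_fun [set: T] h -> (forall x, (0 <= h x)%E) ->
  (\int[PX \x mu]_p h p.1 = \int[PX]_x h x)%E.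
Proof.
move=> mh h0; rewrite fubini_tonelli1//=; last exact: (measurableT_comp mh).
apply: eq_integral => x _; rewrite /fubini_F/= integral_cst//.
rewrite [X in (_ * X)%E](_ : _ = 1%E) ?mule1//; exact: probability_setT.
Qed.

Lemma integral_snd (PX : probability T R) (h : T -> \bar R) :
  measurable_fun [set: T] h -> (forall x, (0 <= h x)%E) ->
  (\int[PX \x mu]_p h p.2 = \int[mu]_x h x)%E.
Proof.
move=> mh h0; rewrite fubini_tonelli2//=; last exact: (measurableT_comp mh).
apply: eq_integral => x _; rewrite /fubini_G/= integral_cst//.
rewrite [X in (_ * X)%E](_ : _ = 1%E) ?mule1//; exact: probability_setT.
Qed.

Lemma capacity_le P : 1 <= P ->
  (capacity mu P <=
   (n%:R / 2 * ln P + (ln C + n%:R * ln 2 + n%:R + m + 2))%:E)%E.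
Proof.
move=> P1; apply/ereal_supP => _ [PX PXP <-].
pose s := Num.sqrt P.
have s1 : 1 <= s by rewrite -[1]sqrtr1 ler_wsqrtr.
have s0 : 0 < s by exact: lt_le_trans s1.
have sP : s ^+ 2 = P by rewrite sqr_sqrtr// (le_trans _ P1).
have C0 : 0 < C by exact: lt_le_trans C_ge1.
have lnP : ln P = 2 * ln s by rewrite -sP lnXn// mulr_natl.
(* [A + l1norm y / s] is exactly ln(C/q_s(y)); [C >= 1] and [s >= 1] make it nonnegative. *)
pose A := ln C + n%:R * ln (2 * s).
have A0 : 0 <= A.
  rewrite addr_ge0 ?ln_ge0// mulr_ge0// ln_ge0//; lra.
pose h (y : T) := A + l1norm y / s.
have h0 y : 0 <= h y by rewrite addr_ge0// divr_ge0 ?l1norm_ge0// ltW.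
have mh : measurable_fun [set: T] h.
  apply: measurable_funD => //; apply: measurable_funM => //.
  exact: measurable_l1norm.
have hq y : ln (C / laplace s y) <= h y.
  rewrite ln_div ?posrE ?laplace_gt0// /laplace ln_div ?posrE ?expR_gt0//; last first.
    by rewrite exprn_gt0// mulr_gt0.
  rewrite expRK lnXn ?mulr_gt0// -[_ *+ n]mulr_natl /h /A; lra.
apply: le_trans (MI_additive_le LE PX mf f_gt0 f_le muE (measurable_laplace s) mh
  (fun y => laplace_gt0 y s0) h0 _ hq) _; first by rewrite (integral_laplace LE).
rewrite (ge0_integral_pushforward (@measurable_joint R n))//=; last 2 first.
- by apply/measurable_EFinP; exact: measurableT_comp.
- by move=> p _; rewrite lee_fin.
rewrite preimage_setT.
(* Separates input from noise: h(x+z) <= h1(x) + |z|_1 by the triangle inequality,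
   [l1norm_le_sqnorm] and 1/s <= 1. *)
pose h1 (x : T) := ((A + n%:R)%:E + (sqnorm x / s ^+ 2)%:E)%E.
have mS : measurable_fun [set: T] (fun x => (sqnorm x / s ^+ 2)%:E).
  by apply/measurable_EFinP; apply: measurable_funM => //; exact: measurable_sqnorm.
have S0 (x : T) : (0 <= (sqnorm x / s ^+ 2)%:E)%E.
  by rewrite lee_fin divr_ge0 ?sqnorm_ge0// exprn_ge0// ltW.
have mh1 : measurable_fun [set: T] h1 by exact: emeasurable_funD.
have h10 x : (0 <= h1 x)%E by rewrite adde_ge0// lee_fin addr_ge0.
have ml : measurable_fun [set: T] (fun z : T => (l1norm z)%:E).
  by apply/measurable_EFinP; exact: measurable_l1norm.
have l0 (z : T) : (0 <= (l1norm z)%:E)%E by rewrite lee_fin l1norm_ge0.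
apply: (@le_trans _ _ (\int[PX \x mu]_p (h1 p.1 + (l1norm p.2)%:E) + 1)%E).
  apply: leeD2r; apply: ge0_le_integral => //.
  - by move=> p _; rewrite lee_fin.
  - apply/measurable_EFinP; apply: measurableT_comp => //.
    exact: (@measurable_vadd2 R n).
  - apply: emeasurable_funD; first exact: (measurableT_comp mh1).
    exact: (measurableT_comp ml).
  move=> [x z] _; rewrite /h1/= -!EFinD lee_fin /h.
  have := l1norm_le_sqnorm x s0.
  have : l1norm (vadd x z) / s <= l1norm x / s + l1norm z / s.
    by rewrite -mulrDl ler_pM2r ?invr_gt0// ler_l1normD.
  have : l1norm z / s <= l1norm z.
    by rewrite ler_pdivrMr// ler_peMr// l1norm_ge0.
  lra.
rewrite ge0_integralD//; last 2 first.
- exact: (measurableT_comp mh1).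
- exact: (measurableT_comp ml).
rewrite integral_fst// (integral_snd PX ml l0).
rewrite ge0_integralD//; last by move=> x _; rewrite lee_fin addr_ge0.
rewrite integral_cst// [X in (_ * X)%E](_ : _ = 1%E) ?mule1; last exact: probability_setT.
have SP : (\int[PX]_x (sqnorm x / s ^+ 2)%:E <= 1)%E.
  under eq_integral do rewrite mulrC EFinM.
  rewrite ge0_integralZl//; last 3 first.
  - by apply/measurable_EFinP; exact: measurable_sqnorm.
  - by move=> x _; rewrite lee_fin sqnorm_ge0.
  - by rewrite lee_fin invr_ge0 exprn_ge0// ltW.
  rewrite sP; apply: (@le_trans _ _ (P^-1%:E * P%:E)%E).
    by rewrite lee_wpmul2l// lee_fin invr_ge0 (le_trans _ P1).
  by rewrite -EFinM mulVf// gt_eqF// (lt_le_trans _ P1).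
(* The first 1 bounds E|X|^2/s^2, which is where s^2 = P matters; the last one bounds the integral
   of q_s. *)
apply: (@le_trans _ _ ((A + n%:R)%:E + 1 + m%:E + 1)%E).
  by apply: leeD2r; apply: leeD => //; apply: leeD2l.
rewrite -!EFinD lee_fin lnP /A lnM ?posrE//; lra.
Qed.

Lemma capacity_ge_laplace_input (s P : R) : 1 <= s ->
  8 * 2 ^+ n * s ^+ 2 <= P ->
  ((n%:R * ln s - m)%:E <= capacity mu P)%E.
Proof.
move=> s1 sP; have s0 : 0 < s by exact: lt_le_trans s1.
have mls : measurable_fun [set: T] (laplace s : T -> R) by exact: measurable_laplace.
have ls0 (x : T) : 0 <= laplace s x by exact: laplace_ge0.
have [PX PXE] := exists_probability_density mls ls0 (integral_laplace LE s0).
apply: (@le_trans _ _ (MI_additive PX mu)); last first.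
  apply: ereal_sup_ubound; exists PX => //=.
  have mS : measurable_fun [set: T] (fun x => (sqnorm x)%:E : \bar R).
    by apply/measurable_EFinP; exact: measurable_sqnorm.
  have S0 (x : T) : (0 <= (sqnorm x)%:E)%E by rewrite lee_fin sqnorm_ge0.
  rewrite (ge0_integral_density mls ls0 PXE)//.
  apply: (@le_trans _ _ (\int[L]_x
      ((8 * 2 ^+ n * s ^+ 2)%:E * (laplace (2 * s) x)%:E))%E).
    apply: ge0_le_integral => //.
    - by move=> x _; rewrite mule_ge0// lee_fin.
    - by apply: emeasurable_funM => //; exact/measurable_EFinP.
    - apply: emeasurable_funM => //; apply/measurable_EFinP; exact: measurable_laplace.
    - by move=> x _; rewrite -!EFinM lee_fin laplace_second_moment.
  have s20 : 0 < 2 * s by rewrite mulr_gt0.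
  rewrite ge0_integralZl//; last 3 first.
  - by apply/measurable_EFinP; exact: measurable_laplace.
  - by move=> x _; rewrite lee_fin laplace_ge0.
  - by rewrite lee_fin !mulr_ge0 ?exprn_ge0// ltW.
  by rewrite (integral_laplace LE)// mule1 lee_fin.
(* Under the joint law [W] is the l1 norm of the noise, so its mean is at most m. *)
pose W (p : T * T) := l1norm (vsub p.2 p.1).
have mW : measurable_fun [set: T * T] W.
  by apply: measurableT_comp; [exact: measurable_l1norm|exact: measurable_vsub2].
have W0 p : 0 <= W p by exact: l1norm_ge0.
have IW : (\int[joint_law PX mu]_p (W p)%:E = \int[mu]_z (l1norm z)%:E)%E.
  rewrite (ge0_integral_pushforward (@measurable_joint R n))//=; last 2 first.
  - exact/measurable_EFinP.
  - by move=> p _; rewrite lee_fin.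
  rewrite preimage_setT -(@integral_snd PX (fun z => (l1norm z)%:E)); last 2 first.
  - by apply/measurable_EFinP; exact: measurable_l1norm.
  - by move=> z; rewrite lee_fin l1norm_ge0.
  by apply: eq_integral => p _; rewrite /W/= vaddK.
have Woo : (\int[joint_law PX mu]_p (W p)%:E < +oo)%E.
  by rewrite IW (le_lt_trans l1_le)// ltry.
have sn1 : 1 <= s ^+ n by exact: exprn_ege1.
apply: le_trans (KL_ge (Q := (PX \x output_law PX mu)%E) sn1 mW W0 Woo _).
  rewrite IW lnXn// -[ln s *+ n]mulr_natl EFinB.
  exact: leeB.
have mexp : measurable_fun [set: T * T] (fun p => (s ^+ n * expR (- W p))%:E).
  apply/measurable_EFinP; apply: measurable_funM => //.
  by apply: measurableT_comp => //; exact: measurableT_comp.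
have exp0 p : (0 <= (s ^+ n * expR (- W p))%:E)%E.
  by rewrite lee_fin mulr_ge0 ?expR_ge0// exprn_ge0// ltW.
(* The integral over x is taken first. For fixed y the bound q_s <= (2s)^-n leaves at most the
   Laplace density of scale 1 centred at y, whose mass is 1. *)
rewrite fubini_tonelli2//.
apply: (@le_trans _ _ (\int[output_law PX mu]_y (cst 1%E y))%E); last first.
  rewrite integral_cst// mul1e [X in (X <= _)%E](_ : _ = 1%E)//.
  exact: probability_setT.
apply: ge0_le_integral => //.
- by move=> y _; apply: integral_ge0.
- exact: measurable_fun_fubini_tonelli_G.
move=> y _; rewrite /fubini_G (ge0_integral_density mls ls0 PXE)//; last first.
  exact: (measurableT_comp mexp (pair2_measurable y)).
have m1 : measurable_fun [set: T] (fun x => (laplace 1 (vsub x y))%:E : \bar R).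
  apply/measurable_EFinP; apply: measurableT_comp; first exact: measurable_laplace.
  exact: (measurableT_comp (@measurable_vsub2 R n) (pair1_measurable y)).
apply: (@le_trans _ _ (\int[L]_x (laplace 1 (vsub x y))%:E)%E).
  apply: ge0_le_integral => //.
  - by move=> x _; rewrite mule_ge0// lee_fin.
  - apply: emeasurable_funM; last exact/measurable_EFinP.
    exact: (measurableT_comp mexp (pair2_measurable y)).
  move=> x _; rewrite -EFinM lee_fin /W/= /laplace.
  have -> : l1norm (vsub y x) = l1norm (vsub x y).
    by apply: eq_bigr => i _; rewrite !tnth_mktuple distrC.
  rewrite divr1 mulr1 exprMn.
  have e1 : expR (- (l1norm x / s)) <= 1.
    by rewrite -expR0 ler_expR oppr_le0 divr_ge0 ?l1norm_ge0// ltW.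
  have E0 := expR_gt0 (- l1norm (vsub x y)).
  rewrite [leLHS](_ : _ =
    expR (- l1norm (vsub x y)) / 2 ^+ n * expR (- (l1norm x / s))).
    by rewrite ler_piMr// divr_ge0// ltW.
  by field; rewrite !expf_neq0// gt_eqF.
have l10 (x : T) : (0 <= (laplace 1 (vsub x y))%:E)%E by rewrite lee_fin laplace_ge0.
rewrite LE// -(leb_int_translation y)//.
by under eq_fun do rewrite vaddK; rewrite leb_int_laplace.
Qed.

Lemma capacity_ge P : 8 * 2 ^+ n <= P ->
  ((n%:R / 2 * ln P - (n%:R / 2 * ln (8 * 2 ^+ n) + m))%:E <= capacity mu P)%E.
Proof.
move=> KP; have K0 : 0 < 8 * 2 ^+ n :> R by rewrite mulr_gt0// exprn_gt0.
have P0 : 0 < P by exact: lt_le_trans KP.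
(* The scale at which the bound 8 2^n s^2 on the input power equals P; the hypothesis on P says s >=
   1. *)
pose s := Num.sqrt (P / (8 * 2 ^+ n)).
have s1 : 1 <= s by rewrite -[1]sqrtr1 ler_wsqrtr// ler_pdivlMr// mul1r.
have s0 : 0 < s by exact: lt_le_trans s1.
have sP : s ^+ 2 = P / (8 * 2 ^+ n) by rewrite sqr_sqrtr// ltW// divr_gt0.
apply: le_trans (capacity_ge_laplace_input s1 _); last first.
  by rewrite sP mulrC divfK// gt_eqF.
have : ln (s ^+ 2) = ln P - ln (8 * 2 ^+ n) by rewrite sP ln_div ?posrE.
rewrite lnXn// mulr2n lee_fin => H; have -> : ln P = ln s + ln s + ln (8 * 2 ^+ n) by lra.
lra.
Qed.

End capacity_bounds.

(** * The Bessel function and the NDFHL density *)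

Section bessel.
Context {R : realType}.
Local Notation leb := (@lebesgue_measure R).
Variable nu : R.
Hypothesis nu0 : 0 <= nu.

Lemma cosh_ge0 (t : R) : 0 <= cosh t.
Proof. by rewrite /cosh divr_ge0// addr_ge0// expR_ge0. Qed.

Lemma cosh_ge1 (t : R) : 1 <= cosh t.
Proof.
have := expR_ge1Dx t; have := expR_ge1Dx (- t).
rewrite /cosh; lra.
Qed.

Lemma cosh_ge_sqr (t : R) : 0 <= t -> t ^+ 2 / 4 <= cosh t.
Proof.
move=> t0; have := expR_ge1Dxn 1 t0; have := expR_gt0 (- t).
rewrite (_ : 2`!%:R = 2 :> R)// /cosh; lra.
Qed.

Lemma cosh_le_expR (t : R) : 0 <= t -> cosh t <= expR t.
Proof.
move=> t0; have : expR (- t) <= expR t by rewrite ler_expR; lra.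
rewrite /cosh; lra.
Qed.

(** One half of z cosh t gives z/2 through cosh t >= 1. The other half dominates z0 t^2/8, a
    Gaussian decay that beats e^(nu t) and leaves the density e^(-t), written in the form expected
    by [integral_expRN_itvcy]. *)
Lemma bessel_integrand_le (z0 z t : R) : 0 < z0 -> z0 <= z -> 0 <= t ->
  expR (- z * cosh t) * cosh (nu * t) <=
  expR (- (z / 2)) * expR (2 * (nu + 1) ^+ 2 / z0) * (1 * expR (- 1 * t)).
Proof.
move=> z00 zz t0; have z_gt0 : 0 < z by exact: lt_le_trans zz.
apply: (@le_trans _ _ (expR (- z * cosh t) * expR (nu * t))).
  by rewrite ler_wpM2l ?expR_ge0// cosh_le_expR// mulr_ge0.
rewrite mul1r -!expRD ler_expR.
(* Completing the square; the maximum is attained at t = 4(nu+1)/z0. *)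
have H : (nu + 1) * t - z0 / 8 * t ^+ 2 <= 2 * (nu + 1) ^+ 2 / z0.
  rewrite ler_pdivlMr//.
  have : 0 <= (z0 * t / 2 - 2 * (nu + 1)) ^+ 2 by rewrite sqr_ge0.
  nra.
have H1 := cosh_ge1 t; have H2 := cosh_ge_sqr t0.
have H3 : z / 2 <= z / 2 * cosh t by rewrite ler_peMr// ltW// divr_gt0.
have H4 : z0 / 2 * (t ^+ 2 / 4) <= z / 2 * cosh t.
  by apply: ler_pM => //; [rewrite divr_ge0// ltW|rewrite divr_ge0// sqr_ge0|lra].
lra.
Qed.

(** Joint measurability in (z, t): sections make the Bessel integrand measurable in t, and Tonelli
    makes [BesselK] measurable in z. *)
Let mexp2 : measurable_fun [set: R * measurableTypeR R]
  (fun p => expR (- p.1 * cosh (p.2 : R)) * cosh (nu * p.2)).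
Proof.
have mcosh : measurable_fun [set: R] (@cosh R).
  apply: measurable_funM => //; apply: measurable_funD => //.
  by apply: measurableT_comp.
have m2 : measurable_fun [set: R * measurableTypeR R] (fun p => p.2 : R).
  exact: measurable_snd.
apply: measurable_funM.
  apply: measurableT_comp => //; apply: measurable_funM.
    by apply: measurableT_comp.
  exact: (measurableT_comp mcosh).
by apply: (measurableT_comp mcosh); exact: measurable_funM.
Qed.

Lemma measurable_BesselK : measurable_fun [set: R] (BesselK nu).
Proof.
pose leb' : {sigma_finite_measure set (measurableTypeR R) -> \bar R} := leb.
pose F (p : R * measurableTypeR R) : \bar R :=
  ((expR (- p.1 * cosh (p.2 : R)) * cosh (nu * p.2)) *
   \1_(`[0%R, +oo[%classic : set (measurableTypeR R)) p.2)%:E.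
have mF : measurable_fun [set: R * measurableTypeR R] F.
  apply/measurable_EFinP; apply: measurable_funM => //.
  by apply: measurableT_comp => //; exact: measurable_indic.
rewrite (_ : BesselK nu = fine \o fubini_F leb' F).
  apply: measurableT_comp => //.
  apply: measurable_fun_fubini_tonelli_F => // p.
  by rewrite lee_fin !mulr_ge0 ?expR_ge0 ?cosh_ge0.
apply/funext => z; congr fine.
rewrite [LHS]integral_mkcond epatch_indic /fubini_F.
by apply: eq_integral => t _; rewrite /F/= EFinM.
Qed.

Let mbessel z : measurable_fun (`[0%R, +oo[%classic : set (measurableTypeR R))
  (fun t : R => (expR (- z * cosh t) * cosh (nu * t))%:E).
Proof.
apply/measurable_EFinP; apply: measurable_funTS.
exact: (measurableT_comp mexp2 (pair1_measurable z)).
Qed.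

Lemma bessel_integral_le (z0 z : R) : 0 < z0 -> z0 <= z ->
  (\int[leb]_(t in `[0%R, +oo[) (expR (- z * cosh t) * cosh (nu * t))%:E <=
   (expR (- (z / 2)) * expR (2 * (nu + 1) ^+ 2 / z0))%:E)%E.
Proof.
move=> z00 zz.
have mexp : measurable_fun [set: R] (fun t : R => 1 * expR (- 1 * t)).
  by apply: measurable_funM => //; apply: measurableT_comp => //; exact: measurable_funM.
rewrite -[leRHS]mule1 -(@integral_expRN_itvcy R 1)// -ge0_integralZl//=; last first.
  by apply/measurable_EFinP/measurable_funTS; exact: mexp.
apply: ge0_le_integral => //=.
- by move=> t _; rewrite lee_fin mulr_ge0 ?expR_ge0 ?cosh_ge0.
- apply: emeasurable_funM => //.
  by apply/measurable_EFinP/measurable_funTS; exact: mexp.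
move=> t; rewrite in_itv/= andbT => t0.
by rewrite -EFinM lee_fin; apply: bessel_integrand_le.
Qed.

(** On [0, 1] the integrand is at least exp(-z e), since cosh t <= e^t <= e and cosh(nu t) >= 1. *)
Lemma bessel_integral_gt0 (z : R) : 0 < z ->
  (0 < \int[leb]_(t in `[0%R, +oo[) (expR (- z * cosh t) * cosh (nu * t))%:E)%E.
Proof.
move=> z0.
apply: (@lt_le_trans _ _ (\int[leb]_(t in `[0%R, 1%R]) (expR (- z * expR 1))%:E)%E).
  rewrite integral_cst//= lebesgue_measure_itv/= lte_fin ltr01 -EFinD subr0 mule1.
  by rewrite lte_fin expR_gt0.
apply: (@le_trans _ _ (\int[leb]_(t in `[0%R, 1%R])
    (expR (- z * cosh t) * cosh (nu * t))%:E)%E).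
  apply: ge0_le_integral => //=.
  - apply: measurable_funS (mbessel z) => //.
    by apply: subset_itvl.
  move=> t; rewrite in_itv/= => /andP[t0 t1]; rewrite lee_fin.
  rewrite -[leLHS]mulr1; apply: ler_pM; rewrite ?expR_ge0 ?cosh_ge1//.
  rewrite ler_expR !mulNr lerN2 ler_pM2l// (le_trans (cosh_le_expR t0))//.
  by rewrite ler_expR.
apply: ge0_subset_integral => //=.
- by move=> t _; rewrite lee_fin mulr_ge0 ?expR_ge0 ?cosh_ge0.
- by apply: subset_itvl.
Qed.

Lemma BesselKE (z : R) : 0 < z -> (BesselK nu z)%:E =
  (\int[leb]_(t in `[0%R, +oo[) (expR (- z * cosh t) * cosh (nu * t))%:E)%E.
Proof.
move=> z0; rewrite fineK// ge0_fin_numE; last exact/ltW/bessel_integral_gt0.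
by apply: le_lt_trans (bessel_integral_le z0 (lexx z)) _; rewrite ltry.
Qed.

Lemma BesselK_gt0 (z : R) : 0 < z -> 0 < BesselK nu z.
Proof. by move=> z0; rewrite -lte_fin BesselKE// bessel_integral_gt0. Qed.

Lemma BesselK_le (z0 z : R) : 0 < z0 -> z0 <= z ->
  BesselK nu z <= expR (- (z / 2)) * expR (2 * (nu + 1) ^+ 2 / z0).
Proof.
move=> z00 zz; rewrite -lee_fin BesselKE ?bessel_integral_le//.
exact: lt_le_trans zz.
Qed.

End bessel.

Section ndfhl.
Context {R : realType}.
Variables (d : nat) (lam u : R).
Hypotheses (d2 : (2 <= d)%N) (lam0 : 0 < lam) (u0 : 0 < u).
Local Notation n := d.-1.
Local Notation T := (n.-tuple R).
Local Notation f := (ndfhl_density d lam u).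

Let rho (x : T) := Num.sqrt (sqnorm x + lam ^+ 2).
Let h : R := d%:R / 2.
Let c1 : R := lam / (powR 2 (h - 1) * powR pi h).

Let h0 : 0 <= h. Proof. by rewrite divr_ge0. Qed.

Let c10 : 0 < c1.
Proof. by rewrite divr_gt0// mulr_gt0// powR_gt0// pi_gt0. Qed.

Let rho_ge_lam x : lam <= rho x.
Proof.
apply: (@le_trans _ _ (Num.sqrt (lam ^+ 2))); first by rewrite sqrtr_sqr ler_norm.
by rewrite ler_wsqrtr// lerDr sqnorm_ge0.
Qed.

Let rho_gt0 x : 0 < rho x. Proof. exact: lt_le_trans (rho_ge_lam x). Qed.

Let l1norm_le_rho x : l1norm x <= n%:R * rho x.
Proof.
rewrite mulr_natl -[n in _ *+ n]card_ord -sumr_const; apply: ler_sum => i _.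
rewrite /rho -sqrtr_sqr ler_wsqrtr// /sqnorm (bigD1 i)//= -addrA lerDl.
by rewrite addr_ge0 ?sqr_ge0// sumr_ge0// => j _; rewrite sqr_ge0.
Qed.

Let urho x : 0 < u * rho x. Proof. exact: mulr_gt0. Qed.

Let fE x : f x = c1 * powR (u / rho x) h * expR (lam * u) * BesselK h (u * rho x).
Proof. by []. Qed.

Lemma ndfhl_density_gt0 x : 0 < f x.
Proof.
rewrite fE mulr_gt0 ?BesselK_gt0// mulr_gt0 ?expR_gt0// mulr_gt0// powR_gt0//.
exact: divr_gt0.
Qed.

Lemma measurable_ndfhl_density : measurable_fun [set: T] f.
Proof.
have mrho : measurable_fun [set: T] rho.
  rewrite /rho; apply: (@measurableT_comp _ _ _ _ _ _ (@Num.sqrt R)).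
    by apply: continuous_measurable_fun; exact: sqrt_continuous.
  by apply: measurable_funD => //; exact: measurable_sqnorm.
apply: measurable_funM; last first.
  by apply: (measurableT_comp (measurable_BesselK h)); exact: measurable_funM.
apply: measurable_funM => //; apply: measurable_funM => //.
apply: (measurableT_comp (measurable_powR _)); apply: measurable_funM => //.
exact: measurable_inv_gt0.
Qed.

(** Since rho >= lam > 0, the argument of the Bessel function stays above u lam, away from the
    singularity at 0, and the bound e^(-u rho/2) supplies the decay. *)
Lemma ndfhl_density_le : exists K c : R, [/\ 0 < K, 0 < c &
  forall x, f x <= K * expR (- (c * l1norm x))].
Proof.
pose B := expR (2 * (h + 1) ^+ 2 / (u * lam)).
(* The power factor is largest at rho = lam, and [B] is the constant of [BesselK_le] for z0 = u lam.
   The rate combines u rho/2 with |x|_1 <= n rho, where n > 0 because d >= 2. *)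
exists (c1 * powR (u / lam) h * expR (lam * u) * B), (u / (2 * n%:R)).
have n0 : 0 < n%:R :> R by rewrite ltr0n -ltnS prednK// (ltn_trans _ d2).
split.
- by rewrite mulr_gt0 ?expR_gt0// mulr_gt0 ?expR_gt0// mulr_gt0// powR_gt0// divr_gt0.
- by rewrite divr_gt0// mulr_gt0.
move=> x; rewrite fE -[leRHS]mulrA; apply: ler_pM.
- by rewrite mulr_ge0 ?expR_ge0// mulr_ge0 ?powR_ge0// ltW.
- exact/ltW/BesselK_gt0.
- rewrite ler_pM2r ?expR_gt0// ler_pM2l//.
  rewrite ge0_ler_powR// ?nnegrE ?divr_ge0 ?(ltW u0) ?(ltW lam0) ?(ltW (rho_gt0 x))//.
  by rewrite ler_pM2l// lef_pV2 ?posrE.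
have ul : 0 < u * lam by rewrite mulr_gt0.
have ulr : u * lam <= u * rho x by rewrite ler_pM2l.
apply: le_trans (BesselK_le h0 ul ulr) _.
rewrite mulrC ler_pM2l ?expR_gt0// ler_expR lerN2.
rewrite (_ : u / _ * _ = u / 2 * (l1norm x / n%:R)); last by field; rewrite gt_eqF.
rewrite (_ : u * rho x / 2 = u / 2 * rho x); last by ring.
by rewrite ler_pM2l ?divr_gt0// ler_pdivrMr// mulrC.
Qed.

End ndfhl.

(** Half of the decay absorbs the norm, by |x|_1 <= (2/c) e^(c|x|_1/2); what remains is a multiple
    of the Laplace density of scale 2/c. *)
Lemma l1norm_moment_le (R : realType) n
    (L : {sigma_finite_measure set (n.-tuple R) -> \bar R})
    (mu : probability (n.-tuple R) R) (f : n.-tuple R -> R) (K c : R) :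
  (forall g : n.-tuple R -> \bar R, measurable_fun [set: n.-tuple R] g ->
    (forall x, (0 <= g x)%E) -> (\int[L]_x g x)%E = leb_int n g) ->
  0 < K -> 0 < c -> measurable_fun [set: n.-tuple R] f -> (forall x, 0 <= f x) ->
  (forall x, f x <= K * expR (- (c * l1norm x))) ->
  (forall A, measurable A -> mu A = (\int[L]_(x in A) (f x)%:E)%E) ->
  (\int[mu]_z (l1norm z)%:E <= (K * (2 / c) * (2 * (2 / c)) ^+ n)%:E)%E.
Proof.
move=> LE K0 c0 mf f0 fK muE; have c20 : 0 < 2 / c by rewrite divr_gt0.
have ml : measurable_fun [set: n.-tuple R] (fun z => (l1norm z)%:E : \bar R).
  by apply/measurable_EFinP; exact: measurable_l1norm.
have l0 (z : n.-tuple R) : (0 <= (l1norm z)%:E)%E by rewrite lee_fin l1norm_ge0.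
rewrite (ge0_integral_density mf f0 muE)//.
pose k := K * (2 / c) * (2 * (2 / c)) ^+ n.
have k0 : 0 <= k by apply/ltW; rewrite mulr_gt0 ?exprn_gt0// mulr_gt0.
have mq : measurable_fun [set: n.-tuple R] (fun z => (laplace (2 / c) z)%:E : \bar R).
  by apply/measurable_EFinP; exact: measurable_laplace.
apply: (@le_trans _ _ (\int[L]_x (k%:E * (laplace (2 / c) x)%:E))%E); last first.
  rewrite ge0_integralZl// ?(integral_laplace LE)// ?mule1// => x _.
  by rewrite lee_fin laplace_ge0.
apply: ge0_le_integral => //.
- by move=> x _; rewrite mule_ge0// lee_fin.
- by apply: emeasurable_funM => //; exact/measurable_EFinP.
- exact: emeasurable_funM.
move=> x _; rewrite -!EFinM lee_fin.
have lx := l1norm_ge0 x.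
have le : l1norm x <= 2 / c * expR (c / 2 * l1norm x).
  have := expR_ge1Dx (c / 2 * l1norm x).
  rewrite -ler_pdivrMl// invf_div; lra.
apply: (@le_trans _ _ (2 / c * expR (c / 2 * l1norm x) * (K * expR (- (c * l1norm x))))).
  exact: ler_pM.
rewrite /laplace /k.
rewrite (_ : - (l1norm x / (2 / c)) = c / 2 * l1norm x + - (c * l1norm x)); last first.
  by field; rewrite gt_eqF.
rewrite expRD le_eqVlt; apply/orP; left; apply/eqP.
have : 0 < (2 * (2 / c)) ^+ n by rewrite exprn_gt0// mulr_gt0.
by set D := _ ^+ n => D0; field; rewrite !gt_eqF.
Qed.

Unset Implicit Arguments.

(** * Capacity asymptotics for NDFHL noise *)

Theorem theorem1 (R : realType) (d : nat) (lam u : R)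
  (mu : probability (d.-1.-tuple R) R) :
  (2 <= d)%N -> 0 < lam -> 0 < u -> is_NDFHL d lam u mu ->
  exists M : R, exists P0 : R, forall P : R, P0 <= P ->
    ((d.-1%:R / 2 * ln P - M)%:E <= capacity mu P)%E /\
    (capacity mu P <= (d.-1%:R / 2 * ln P + M)%:E)%E.
Proof.
move=> d2 lam0 u0 muN.
have [L LE] := @leb_int_measure R d.-1.
pose f := ndfhl_density d lam u.
have mf : measurable_fun [set: d.-1.-tuple R] f by exact: measurable_ndfhl_density.
have f0 x : 0 < f x by exact: ndfhl_density_gt0.
have [K [c [K0 c0 fK]]] := ndfhl_density_le d2 lam0 u0.
have muE A : measurable A -> mu A = (\int[L]_(x in A) (f x)%:E)%E.
  move=> mA; rewrite muN// -LE; last 2 first.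
  - by apply/measurable_EFinP; apply: measurable_funM.
  - by move=> x; rewrite lee_fin mulr_ge0// ltW.
  rewrite [RHS]integral_mkcond epatch_indic; apply: eq_integral => x _.
  by rewrite /= -EFinM mulrC.
(* The exponential factor in [fK] is at most 1, so [K] bounds f; the maximum with 1 provides
   [C >= 1] for [capacity_le]. *)
pose C := Num.max 1 K.
have C1 : 1 <= C by rewrite le_max lexx.
have fC x : f x <= C.
  rewrite le_max; apply/orP; right; apply: le_trans (fK x) _.
  by rewrite ger_pMr// -expR0 ler_expR oppr_le0 mulr_ge0 ?l1norm_ge0// ltW.
have mle := l1norm_moment_le LE K0 c0 mf (fun x => ltW (f0 x)) fK muE.
set m : R := _ * _ in mle.
pose M1 := d.-1%:R / 2 * ln (8 * 2 ^+ d.-1) + m : R.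
pose M2 := ln C + d.-1%:R * ln 2 + d.-1%:R + m + 2 : R.
have K8 : 1 <= 8 * 2 ^+ d.-1 :> R.
  have : 1 <= 2 ^+ d.-1 :> R by rewrite exprn_ege1// ler1n.
  lra.
(* The threshold is the one of [capacity_ge], and it also ensures P >= 1 for [capacity_le]. *)
exists (Num.max M1 M2), (8 * 2 ^+ d.-1) => P PK; split.
- apply: le_trans (capacity_ge LE mle PK).
  by rewrite lee_fin lerD2l lerN2 le_max lexx.
- apply: le_trans (capacity_le LE mf f0 fC C1 muE mle (le_trans K8 PK)) _.
  by rewrite lee_fin lerD2l le_max lexx orbT.
Qed.
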